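(* Let $P_1$ and $P_2$ be two nonzero natural numbers, and let $n$ be a nonzero natural number. If $P_1$ and $P_2$ have the same parity, then the two generated Collatz sequences $\tilde S(P_1,n)$ and $\tilde S(P_2,n)$ are isochromatic if and only if there exists a nonzero natural number $m$ such that $P_2=P_1+2^{n+1}m$. In other words: $\big(\mathbf{i}_0(P_2)=\mathbf{i}_0(P_1)$ and $\tilde L(P_1,n)=\tilde L(P_2,n)\big)\Leftrightarrow P_2=P_1+2^{n+1}m$ (for some nonzero natural number $m$).
   Context: The Collatz map on positive integers is $T(N)=N/2$ if $N$ is even and $T(N)=(3N+1)/2$ if $N$ is odd; $T_k$ denotes its $k$-fold iterate, with $T_0(N)=N$. The parity indicator of order $k\ge 0$ is $\mathbf{i}_k(P)=1$ if $T_k(P)$ is odd and $0$ otherwise. The generated sequence of length $n$ with generator $P$ is $\tilde S(P,n)=(T_1(P),\dots,T_n(P))$ (it excludes $P$ itself); its structural distribution is $\tilde L(P,n)=(\mathbf{i}_1(P),\dots,\mathbf{i}_n(P))$. Two generated sequences of the same length are isochromatic (isoform) if they have the same structural distribution.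
   Formalization: The formal theorem additionally assumes P_1 < P_2; without it the equivalence fails, e.g. for P_1 = P_2 (which would need m = 0) or P_1 = 5, P_2 = 1, n = 1 (isochromatic, but 1 = 5 + 4m has no natural solution). *)

(* Defs.v *)
From mathcomp Require Import all_boot.

Set Implicit Arguments.
Unset Strict Implicit.
Unset Printing Implicit Defensive.

Definition collatz (N : nat) : nat :=
  if odd N then (3 * N + 1)./2 else N./2.

Definition collatz_iter (k N : nat) : nat := iter k collatz N.

Definition parity (N : nat) : nat := if odd N then 1 else 0.

Definition parity_indicator (k P : nat) : nat := parity (collatz_iter k P).

(* [iota 1 n] is 1, ..., n: the generator P = T_0(P) is not a term. *)
Definition generated_seq (P n : nat) : seq nat :=
  [seq collatz_iter k P | k <- iota 1 n].

Definition structural_distribution (P n : nat) : seq nat :=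
  [seq parity_indicator k P | k <- iota 1 n].

(* On generated sequences, the list of parities of the terms is the structural
   distribution: see [map_parity_generated_seq]. *)
Definition isochromatic (s1 s2 : seq nat) : Prop :=
  size s1 = size s2 /\ map parity s1 = map parity s2.

Lemma map_parity_generated_seq (P n : nat) :
  map parity (generated_seq P n) = structural_distribution P n.
Proof. by rewrite /generated_seq -map_comp. Qed.

Lemma isochromatic_generated_seq (P1 P2 n : nat) :
  isochromatic (generated_seq P1 n) (generated_seq P2 n) <->
  structural_distribution P1 n = structural_distribution P2 n.
Proof.
rewrite /isochromatic !map_parity_generated_seq !size_map.
by split=> [[]|].
Qed.

(* Main.v *)
Require Import Defs.
From mathcomp Require Import all_boot.
From mathcomp Require Import zify.

(** On each parity class [T] is an affine map of slope [1/2] or [3/2], and [3]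
    is invertible modulo [2 ^ n].  So the residue of [N] modulo [2 ^ n.+1]
    carries the same information as the parity of [N] and the residue of [T N]
    modulo [2 ^ n]; by induction, the residue modulo [2 ^ n] is equivalent to
    the parities of [T_0 N], ..., [T_n.-1 N]. *)

Lemma eqn_mod_pmul2l p a b d : 0 < p ->
  (p * a == p * b %[mod p * d]) = (a == b %[mod d]).
Proof. by move=> p_gt0; rewrite -!muln_modr eqn_pmul2l. Qed.

Lemma eqn_mod_coprime_mul2l p a b d : coprime d p ->
  (p * a == p * b %[mod d]) = (a == b %[mod d]).
Proof.
move=> co_dp; wlog le_ba : a b / b <= a => [IH|].
  by case/orP: (leq_total b a) => /IH // E; rewrite eq_sym E eq_sym.
by rewrite !eqn_mod_dvd ?leq_mul // -mulnBr Gauss_dvdr.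
Qed.

(** In terms of the half [m] the slopes become [1] and [3], so no division remains:
    [(3(2m + 1) + 1)/2 = 3m + 2]. *)
Lemma collatz_bit_double (b : bool) m :
  collatz (b + m.*2) = if b then 3 * m + 2 else m.
Proof.
rewrite /collatz oddD oddb odd_double addbF.
by case: b; rewrite ?add0n ?doubleK //; lia.
Qed.

Lemma eqn_mod_collatz n a b :
  (a == b %[mod 2 ^ n.+1]) =
  (odd a == odd b) && (collatz a == collatz b %[mod 2 ^ n]).
Proof.
have [eq_odd|neq_odd] /= := eqVneq (odd a) (odd b); last first.
  (* The modulus [2 ^ n.+1] is even, so reduction preserves parity. *)
  apply/eqP => /(congr1 odd) eq_mod; move/eqP: neq_odd; apply.
  by move: eq_mod; rewrite !odd_mod // oddX.
rewrite -(odd_double_half a) -(odd_double_half b) -eq_odd !collatz_bit_double.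
rewrite eqn_modDl -!mul2n expnS eqn_mod_pmul2l //.
(* Both sides now compare halves modulo [2 ^ n]; in the odd case the shift [2] and the factor [3],
   coprime to [2 ^ n], cancel. *)
case: (odd a) => //.
by rewrite eqn_modDr eqn_mod_coprime_mul2l // coprimeXl.
Qed.

Lemma eq_parity_odd a b : parity a = parity b <-> odd a = odd b.
Proof. by rewrite /parity; case: (odd a); case: (odd b). Qed.

Lemma parity_indicatorS k P :
  parity_indicator k.+1 P = parity_indicator k (collatz P).
Proof. by rewrite /parity_indicator /collatz_iter iterSr. Qed.

Lemma parity_indicator_eq_mod n a b :
  (forall k, k < n -> parity_indicator k a = parity_indicator k b) <->
  a = b %[mod 2 ^ n].
Proof.
elim: n a b => [|n IHn] a b; first by rewrite !modn1.
split=> [eq_ind | /eqP].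
  apply/eqP; rewrite eqn_mod_collatz; apply/andP; split; apply/eqP.
    exact/eq_parity_odd/(eq_ind 0).
  by apply/IHn => k lt_kn; rewrite -!parity_indicatorS eq_ind.
rewrite eqn_mod_collatz => /andP[/eqP eq_odd /eqP/IHn eq_ind] [_ | k lt_kn].
  exact/eq_parity_odd.
by rewrite !parity_indicatorS eq_ind.
Qed.

(** The distribution covers orders [1] to [n]; the equality at order [0] completes it to [n.+1]
    parities, whence the exponent [n.+1]. *)
Lemma structural_distribution_eq_mod n a b :
  (parity_indicator 0 b = parity_indicator 0 a /\
   structural_distribution a n = structural_distribution b n) <->
  a = b %[mod 2 ^ n.+1].
Proof.
split=> [[eq0 /eq_in_map eq_ind] | /parity_indicator_eq_mod eq_ind].
  apply/parity_indicator_eq_mod => -[//|k lt_kn].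
  by apply: eq_ind; rewrite mem_iota.
split; first by rewrite eq_ind.
by apply/eq_in_map => k; rewrite mem_iota => /andP[_]; apply: eq_ind.
Qed.

Lemma eq_mod_ltn_exists a b d : a < b ->
  a = b %[mod d] <-> exists m, 0 < m /\ b = a + d * m.
Proof.
move=> lt_ab; split=> [/esym/eqP | [m [_ ->]]]; last first.
  by rewrite mulnC addnC modnMDl.
rewrite eqn_mod_dvd ?(ltnW lt_ab) // => /dvdnP[m def_m].
(* The quotient [m] is positive because [m * d = b - a] is. *)
exists m; rewrite mulnC -def_m subnKC ?(ltnW lt_ab) //; split=> //.
by move: lt_ab; rewrite -subn_gt0 def_m muln_gt0 => /andP[].
Qed.

(** The hypothesis [hlt] fixes the order of the generators: a nonzero [m] forces [P1 < P2], whereas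
    equal generators are isochromatic with [m = 0] only. *)
Theorem theorem3p3 (P1 P2 n : nat) (hP1 : 0 < P1) (hP2 : 0 < P2) (hn : 0 < n)
    (hlt : P1 < P2) :
  (parity_indicator 0 P2 = parity_indicator 0 P1 ->
     (isochromatic (generated_seq P1 n) (generated_seq P2 n) <->
      exists m : nat, 0 < m /\ P2 = P1 + 2 ^ n.+1 * m)) /\
  ((parity_indicator 0 P2 = parity_indicator 0 P1 /\
    structural_distribution P1 n = structural_distribution P2 n) <->
   exists m : nat, 0 < m /\ P2 = P1 + 2 ^ n.+1 * m).
Proof.
have key := iff_trans (structural_distribution_eq_mod n P1 P2)
  (eq_mod_ltn_exists _ _ (2 ^ n.+1) hlt).
split=> // eq0; rewrite isochromatic_generated_seq -key.
by split=> [|[]].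
Qed.
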